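(* Let $A_i\in\mathbb{R}^{n\times m_i}$, $i=1,\dots,d$, and let $Z^{(1)},Z^{(2)},\dots\in\mathbb{R}^{n\times p}$ and $Y_i^{(1)},Y_i^{(2)},\dots\in\mathbb{R}^{n\times p}$ be the matrices generated by the federated simultaneous subspace iteration, so that in particular $Y_i^{(j)}=A_iA_i^\top Z^{(j)}$ for all $i$ and $j$. Let $\mathcal{Z}_k=[Z^{(1)}\; Z^{(2)}\;\cdots\; Z^{(k)}]\in\mathbb{R}^{n\times kp}$, and suppose that $k$ is sufficiently large so that $\mathrm{rank}(\mathcal{Z}_k)=n$. Then for $i=1,2,\dots,d$, $$A_iA_i^\top=\left[Y_i^{(1)}\; Y_i^{(2)}\;\cdots\; Y_i^{(k)}\right]\mathcal{Z}_k^\top\left(\mathcal{Z}_k\mathcal{Z}_k^\top\right)^{-1}.$$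
   Context: The data matrix is $A=[A_1\;\cdots\;A_d]\in\mathbb{R}^{n\times m}$ with blocks $A_i\in\mathbb{R}^{n\times m_i}$, $m_1+\dots+m_d=m$, and $n\le m$. For a matrix $M$, $\mathbf{orth}(M)$ denotes the set of orthonormal bases (as matrices with orthonormal columns) of the range space of $M$. The federated simultaneous subspace iteration (SSI) generates $Z^{(k+1)}\in\mathbf{orth}\left(\sum_{i=1}^d Y_i^{(k)}\right)$ with $Y_i^{(k)}=A_iA_i^\top Z^{(k)}$, where $Z^{(k)}\in\mathbb{R}^{n\times p}$ has orthonormal columns. *)

(* Defs.v *)
From mathcomp Require Import all_boot all_order all_algebra.
From mathcomp Require Import reals.

Set Implicit Arguments.
Unset Strict Implicit.
Unset Printing Implicit Defensive.

Import GRing.Theory.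
Local Open Scope ring_scope.

Definition orthonormal_columns (R : realType) (n r : nat) (Q : 'M[R]_(n, r))
    : bool :=
  Q^T *m Q == 1%:M.

(* MathComp's [_ == _ %MS] compares row spaces, so the equality of the range
   (column) spaces of [Q] and [M] is stated on the transposes.  The width [r]
   of [Q] may differ from that of [M], and is forced to be the rank of [M]. *)
Definition orth (R : realType) (n q r : nat) (M : 'M[R]_(n, q))
    : pred 'M[R]_(n, r) :=
  [pred Q | orthonormal_columns Q && (Q^T == M^T)%MS].
Arguments orth {R n q r} M.

(* Iterates are numbered from 1: the values at [j = 0] are unconstrained. *)
Definition federated_ssi (R : realType) (n p d : nat) (m : 'I_d -> nat)
    (A : forall i : 'I_d, 'M[R]_(n, m i))
    (Z : nat -> 'M[R]_(n, p)) (Y : 'I_d -> nat -> 'M[R]_(n, p)) : Prop :=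
  [/\ orthonormal_columns (Z 1%N),
      forall (i : 'I_d) (j : nat), (0 < j)%N ->
        Y i j = A i *m (A i)^T *m Z j
    & forall j : nat, (0 < j)%N -> Z j.+1 \in orth (\sum_(i < d) Y i j)].

(* Main.v *)
Require Import Defs.
From mathcomp Require Import all_boot all_order all_algebra.
From mathcomp Require Import reals.

Import GRing.Theory Num.Theory.
Local Open Scope ring_scope.

(** Each step applies the same linear map $A_iA_i^\top$ to the current iterate, so stacking the
    blocks gives $Y = A_iA_i^\top \mathcal{Z}_k$. Multiplying on the right by $\mathcal{Z}_k^\top$
    and cancelling the Gram matrix recovers $A_iA_i^\top$. That matrix is invertible by
    [row_free_gram_unitmx], which rests on sums of squares being definite ([mulmx_tr_eq0]). *)

Lemma mulmx_tr_eq0 (R : realDomainType) (n : nat) (v : 'rV[R]_n) :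
  v *m v^T = 0 -> v = 0.
Proof.
move=> /matrixP /(_ 0 0); rewrite !mxE => /eqP.
rewrite psumr_eq0 => [/allP v0|j _]; last by rewrite mxE -expr2 sqr_ge0.
apply/rowP => j; move: (v0 j (mem_index_enum j)).
by rewrite /= !mxE mulf_eq0 orbb => /eqP.
Qed.

(** If $v M M^\top = 0$, then $(vM)(vM)^\top = 0$, so $vM = 0$, and independence of the rows of [M]
    gives $v = 0$. *)
Lemma row_free_gram_unitmx (R : realFieldType) (n q : nat) (M : 'M[R]_(n, q)) :
  row_free M -> M *m M^T \in unitmx.
Proof.
move=> freeM; rewrite -row_free_unit -kermx_eq0.
apply/rowV0P => v /sub_kermxP vMMT0.
apply: (row_free_inj freeM); rewrite mul0mx; apply: mulmx_tr_eq0.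
by rewrite trmx_mul mulmxA -(mulmxA v) vMMT0 mul0mx.
Qed.

Theorem proposition2 (R : realType) (n p d : nat) (m : 'I_d -> nat)
    (A : forall i : 'I_d, 'M[R]_(n, m i))
    (Z : nat -> 'M[R]_(n, p)) (Y : 'I_d -> nat -> 'M[R]_(n, p)) (k : nat)
    (n_le_m : (n <= \sum_(i < d) m i)%N)
    (ssiZY : federated_ssi A Z Y)
    (rankZ : \rank (\mxrow_(j < k) Z j.+1) = n) :
  let Zk := \mxrow_(j < k) Z j.+1 in
  Zk *m Zk^T \in unitmx /\
  forall i : 'I_d,
    A i *m (A i)^T
    = (\mxrow_(j < k) Y i j.+1) *m Zk^T *m invmx (Zk *m Zk^T).
Proof.
have [_ defY _] := ssiZY; move=> Zk.
have unitG : Zk *m Zk^T \in unitmx.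
  by apply: row_free_gram_unitmx; rewrite /row_free rankZ.
split=> // i; set Yk := \mxrow_(j < k) _.
have -> : Yk = A i *m (A i)^T *m Zk.
  (* The blocks carry the index [j.+1], which is positive, so [defY] applies to each of them. *)
  by rewrite mul_mxrow; apply: eq_mxrow => j; rewrite defY.
by rewrite -(mulmxA _ Zk) mulmxK.
Qed.
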